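(* Let $n \geq 2$ be an integer. The eigenvalues (with multiplicity) of the adjacency matrix of the graph $(\overline{S_{n,n}})^+$ are \[ n-1+\sqrt{n^2-3n+3},\quad -1+\sqrt{n-1},\quad -1-\sqrt{n-1},\quad n-1-\sqrt{n^2-3n+3}, \] together with $-1$ of multiplicity $2n-4$.
   Context: For positive integers $n_1, n_2$, the double star $S_{n_1,n_2}$ is the graph obtained by taking disjoint stars $K_{1,n_1-1}$ (with center $v_1$) and $K_{1,n_2-1}$ (with center $v_2$) and adding the edge $v_1v_2$. $\overline{S_{n_1,n_2}}$ denotes its complement (in which $v_1$ and $v_2$ are non-adjacent), and $(\overline{S_{n_1,n_2}})^+$ denotes the graph obtained from $\overline{S_{n_1,n_2}}$ by adding the edge $v_1v_2$. Thus $(\overline{S_{n,n}})^+$ consists of two cliques $K_{n-1}$ (the leaves of each star) joined completely to each other, with $v_1$ adjacent exactly to all vertices of the clique formed by the leaves of the second star and to $v_2$, and $v_2$ adjacent exactly to all vertices of the clique formed by the leaves of the first star and to $v_1$. *)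

(* Defs.v *)
From HB Require Import structures.
From mathcomp Require Import all_boot all_order all_algebra.

Set Implicit Arguments.
Unset Strict Implicit.
Unset Printing Implicit Defensive.

Import GRing.Theory.
Local Open Scope ring_scope.

Record sgraph := SGraph {
  vertex :> finType;
  edge : rel vertex;
  edge_sym : symmetric edge;
  edge_irr : irreflexive edge }.

Section Star.
Variable m : nat.

(* K_{1,m}: [None] is the center, [Some i] are the m leaves. *)
Definition star_edge : rel (option 'I_m) :=
  fun x y => (x == None) (+) (y == None).

Lemma star_edge_sym : symmetric star_edge.
Proof. by move=> x y; rewrite /star_edge addbC. Qed.

Lemma star_edge_irr : irreflexive star_edge.
Proof. by move=> x; rewrite /star_edge addbb. Qed.

Definition star : sgraph := SGraph star_edge_sym star_edge_irr.
End Star.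

Section DisjointUnion.
Variables G H : sgraph.

Definition dunion_edge : rel (G + H)%type := fun x y =>
  match x, y with
  | inl a, inl b => edge a b
  | inr a, inr b => edge a b
  | _, _ => false
  end.

Lemma dunion_edge_sym : symmetric dunion_edge.
Proof. by case=> a [] b //=; apply: edge_sym. Qed.

Lemma dunion_edge_irr : irreflexive dunion_edge.
Proof. by case=> a /=; apply: edge_irr. Qed.

Definition dunion : sgraph := SGraph dunion_edge_sym dunion_edge_irr.
End DisjointUnion.

Section Complement.
Variable G : sgraph.

Definition compl_edge : rel G := fun x y => (x != y) && ~~ edge x y.

Lemma compl_edge_sym : symmetric compl_edge.
Proof. by move=> x y; rewrite /compl_edge eq_sym edge_sym. Qed.

Lemma compl_edge_irr : irreflexive compl_edge.
Proof. by move=> x; rewrite /compl_edge eqxx. Qed.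

Definition compl : sgraph := SGraph compl_edge_sym compl_edge_irr.
End Complement.

Section AddEdge.
Variables (G : sgraph) (u v : G).

(* The guard [x != y] only matters when [u = v]; the graph is then unchanged. *)
Definition add_edge_edge : rel G := fun x y =>
  edge x y ||
  ((x != y) && (((x == u) && (y == v)) || ((x == v) && (y == u)))).

Lemma add_edge_edge_sym : symmetric add_edge_edge.
Proof.
move=> x y; rewrite /add_edge_edge edge_sym [x == y]eq_sym; congr (_ || (_ && _)).
by rewrite orbC [(y == v) && _]andbC [(y == u) && _]andbC.
Qed.

Lemma add_edge_edge_irr : irreflexive add_edge_edge.
Proof. by move=> x; rewrite /add_edge_edge edge_irr eqxx. Qed.

Definition add_edge : sgraph := SGraph add_edge_edge_sym add_edge_edge_irr.
End AddEdge.

Section DoubleStar.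
Variables n1 n2 : nat.

(* Meaningful for n1, n2 >= 1: K_{1,0} is a single vertex. *)
Definition two_stars : sgraph := dunion (star n1.-1) (star n2.-1).

Definition center1 : two_stars := inl None.
Definition center2 : two_stars := inr None.

Definition dstar : sgraph := add_edge center1 center2.

Definition compl_dstar_plus : sgraph :=
  @add_edge (compl dstar) center1 center2.
End DoubleStar.

Definition adjmx (R : pzRingType) (G : sgraph) : 'M[R]_#|G| :=
  \matrix_(i, j) (edge (enum_val i) (enum_val j))%:R.

(* [s] lists the eigenvalues of [A], each repeated according to its algebraic
   multiplicity (which is the geometric one when [A] is a real symmetric
   matrix). *)
Definition spectrum_is (R : fieldType) (k : nat) (A : 'M[R]_k) (s : seq R) :=
  char_poly A = \prod_(x <- s) ('X - x%:P).

(* Main.v *)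
(** Adding the identity to the adjacency matrix makes every row depend only on
    the class of the vertex ([v_1], [v_2], leaf of [v_1], leaf of [v_2]), so
    [A + 1 = P C P^T] with [P] the [2n x 4] class indicator matrix.  Sylvester's
    determinant identity then reduces the characteristic polynomial to a
    [4 x 4] determinant in [X + 1], the remaining factor being
    [(X + 1)^(2n - 4)]. *)
Require Import Defs.
From mathcomp Require Import all_boot all_order all_algebra.
From mathcomp Require Import ring lra.

Import Order.TTheory GRing.Theory Num.Theory.
Local Open Scope ring_scope.

(** Both sides equal [y ^+ k * \det M] for the block matrix [M] with rows [(y, A)] and [(B, 1)]:
    block elimination on the right and on the left clears [B]. Scaling by [y] replaces dividing by
    it, so any commutative ring will do. *)
Lemma sylvester_det (S : comPzRingType) (m k : nat) (A : 'M[S]_(m, k))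
    (B : 'M[S]_(k, m)) (y : S) :
  y ^+ k * \det (y%:M - A *m B) = y ^+ m * \det (y%:M - B *m A).
Proof.
pose M := block_mx y%:M A B 1%:M.
have detM : \det M = \det (y%:M - A *m B).
  have := det_mulmx M (block_mx 1%:M 0 (- B) 1%:M).
  rewrite det_lblock !det1 !mulr1 mulmx_block !mulmx0 !mulmx1 mul1mx !add0r.
  by rewrite mulmxN addrN det_ublock det1 mulr1 => <-.
have := det_mulmx (block_mx 1%:M 0 (- B) y%:M) M.
rewrite det_lblock det1 mul1r det_scalar detM mulmx_block !mul0mx !mul1mx !addr0.
rewrite mul_mx_scalar mul_scalar_mx scalerN addNr det_ublock det_scalar mulmx1.
by rewrite addrC mulNmx => <-.
Qed.

(** The two factors come from the swap of the two stars: vectors [(a, -a, b, -b)] give [y ^+ 2 - m],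
    vectors [(a, a, b, b)] give the other one. *)
Lemma det_quotient (S : comPzRingType) (y m : S) :
  \det (y%:M - \matrix_(i < 4, j < 4)
                 ((j != i + 2)%:R * (if (j < 2)%N then 1 else m))) =
  (y ^+ 2 - m) * (y ^+ 2 - 2 * (m + 1) * y + 3 * m).
Proof.
do 3!rewrite !(expand_det_row _ ord0) !big_ord_recl !big_ord0 /cofactor.
rewrite !det_mx11 !mxE /=.
rewrite /eq_op /= /bump /=.
ring.
Qed.

(* Numbered so that the only non-adjacent classes, a center and its own leaves,
   are those that differ by 2 modulo 4. *)
Definition vclass {n : nat} (x : compl_dstar_plus n n) : 'I_4 :=
  match x with
  | inl None => 0 | inr None => 1 | inl (Some _) => 2 | inr (Some _) => 3
  end.

Lemma edge_vclass (n : nat) (x y : compl_dstar_plus n n) :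
  edge x y = (x != y) && (vclass y != vclass x + 2).
Proof.
by case: x y => [[?|]|[?|]] [[?|]|[?|]];
  rewrite /= /add_edge_edge /= /compl_edge /= /add_edge_edge /= /star_edge /=
          ?andbT ?andbF ?orbF //= andbT.
Qed.

Lemma sum_option (V : nmodType) (T : finType) (F : option T -> V) :
  \sum_x F x = F None + \sum_x F (Some x).
Proof.
rewrite (bigD1 None) //=; congr (_ + _).
rewrite (reindex_omap Some id) => [|[x|] //]; apply: eq_bigl => x.
by rewrite eqxx.
Qed.

Lemma sum_vclass (V : nmodType) (n : nat) (F : 'I_4 -> V) :
  \sum_(x : compl_dstar_plus n n) F (vclass x) =
  \sum_c F c *+ (if (c < 2)%N then 1%N else n.-1).
Proof.
rewrite big_sumType /= !sum_option /= !sumr_const card_ord.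
rewrite !big_ord_recl big_ord0 /= addr0.
rewrite addrACA !addrA !mulr1n.
by congr (F _ + F _ + F _ *+ _ + F _ *+ _); exact: val_inj.
Qed.

Lemma card_compl_dstar_plus (n : nat) : (0 < n)%N ->
  #|compl_dstar_plus n n| = (2 * n)%N.
Proof. by case: n => // n _; rewrite card_sum card_option card_ord mul2n addnn. Qed.

Lemma char_poly_compl_dstar_plus (R : idomainType) (n : nat) : (2 <= n)%N ->
  let y := 'X + 1 in
  let m : {poly R} := n.-1%:R in
  char_poly (adjmx R (compl_dstar_plus n n)) =
  (y ^+ 2 - m) * (y ^+ 2 - 2 * (m + 1) * y + 3 * m) * y ^+ (2 * n - 4).
Proof.
move=> n2 y m; set G := compl_dstar_plus n n.
pose P : 'M[{poly R}]_(#|G|, 4) :=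
  \matrix_(i, a) (a == vclass (enum_val i))%:R.
pose Q : 'M[{poly R}]_(4, #|G|) :=
  \matrix_(a, i) (vclass (enum_val i) != a + 2)%:R.
have -> : char_poly (adjmx R G) = \det (y%:M - P *m Q).
  congr (\det _); apply/matrixP => i j.
  rewrite !mxE edge_vclass (inj_eq enum_val_inj) polyC_natr.
  rewrite (bigD1 (vclass (enum_val i))) //= !mxE eqxx mul1r big1; last first.
    by move=> a /negPf ne; rewrite mxE ne mul0r.
  rewrite addr0.
  case: eqVneq => [->|_] /=; last by rewrite !mulr0n !sub0r.
  rewrite !mulr1n subr0.
  (* On the diagonal [P *m Q] has entry 1, which cancels the shift from ['X] to [y]. *)
  have -> : vclass (enum_val j) != vclass (enum_val j) + 2.
    by case: (vclass _) => -[|[|[|[|]]]].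
  by rewrite addrK.
(* Sylvester's identity carries a factor [y ^+ 4] on the left, cancelled in the domain
   [{poly R}]. *)
have y0 : y != 0 by rewrite -size_poly_eq0 /y -polyC1 size_XaddC.
apply: (mulfI (expf_neq0 4 y0)).
rewrite sylvester_det.
(* Entry [(a, b)] is the size of class [b], or 0 if [b = a + 2]. *)
have -> : Q *m P = \matrix_(i < 4, j < 4)
                 ((j != i + 2)%:R * (if (j < 2)%N then 1 else m)).
  apply/matrixP => a b; rewrite !mxE.
  under eq_bigr do rewrite !mxE.
  rewrite -(big_enum_val (fun x => (vclass x != a + 2)%:R * (b == vclass x)%:R)).
  rewrite (sum_vclass _ n (fun c => (c != a + 2)%:R * (b == c)%:R)).
  rewrite (bigD1 b) //= eqxx mulr1 big1 => [|c /negPf ne]; last first.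
    by rewrite [b == c]eq_sym ne mulr0 mul0rn.
  by rewrite addr0; case: ifP => _; rewrite ?mulr1 // mulr_natr.
rewrite det_quotient card_compl_dstar_plus ?(ltnW n2)//.
(* The truncated difference [2 * n - 4] is a true one because [2 <= n]. *)
rewrite [in RHS]mulrCA -exprD subnKC 1?mulrC//.
by rewrite (leq_mul2l 2 2).
Qed.

Theorem theorem3p6 (R : rcfType) (n : nat) (hn : (2 <= n)%N) :
  spectrum_is (adjmx R (compl_dstar_plus n n))
    ([:: n%:R - 1 + Num.sqrt (n%:R ^+ 2 - 3 * n%:R + 3);
         - 1 + Num.sqrt (n%:R - 1);
         - 1 - Num.sqrt (n%:R - 1);
         n%:R - 1 - Num.sqrt (n%:R ^+ 2 - 3 * n%:R + 3)]
     ++ nseq (2 * n - 4)%N (- 1)).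
Proof.
have r1 : 0 <= n%:R - 1 :> R by rewrite subr_ge0 ler1n ltnW.
have r2 : 0 <= n%:R ^+ 2 - 3 * n%:R + 3 :> R.
  (* Four times the radicand is [(2 * n - 3) ^+ 2 + 3]. *)
  by have := sqr_ge0 (2 * n%:R - 3 : R); lra.
have /(congr1 (@polyC R)) := sqr_sqrtr r1.
have /(congr1 (@polyC R)) := sqr_sqrtr r2.
set s := Num.sqrt _; set t := Num.sqrt _.
rewrite !(polyCD, polyCN, polyCM, polyC1, exprS, polyC_natr, expr0, mulr1) => Es Et.
rewrite /spectrum_is char_poly_compl_dstar_plus // big_cat big_nseq /=.
rewrite -Monoid.iteropE !big_cons big_nil.
rewrite !(polyCD, polyCN, polyCM, polyC1, polyC_natr).
clearbody s t; rewrite opprK; congr (_ * _).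
have -> : n.-1%:R = n%:R - 1 :> {poly R} by rewrite -subn1 natrB// ltnW.
move: 'X s%:P t%:P (n%:R) Es Et => x {}s {}t a Es Et.
(* Conjugate roots pair up into differences of squares, so the square roots enter only through [Es]
   and [Et]. *)
transitivity (((x + 1) ^+ 2 - t * t) *
              ((x - a + 1) ^+ 2 - s * s)); last by ring.
by rewrite Es Et; ring.
Qed.
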